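(* Let $(W,S)_B$ be a Lorentzian Coxeter system, let $(w_k)_{k\in\mathbb N}$ be a sequence in $W$ and let $\mathbf x_0\in V\setminus\{0\}$ be a base point. If the sequence $(w_k\cdot\widehat{\mathbf x}_0)_{k\in\mathbb N}$ in $\mathbb{P}V$ is injective and converges to a limit direction $\widehat{\mathbf x}$ in the projective light cone $\widehat Q$, then $\widehat{\mathbf x}$ is a limit root.
   Context: Let $(W,S)$ be a Coxeter system with $S$ finite, $|S|=n$ (the rank), with relations $(st)^{m_{st}}=e$, $m_{ss}=1$, $m_{st}=m_{ts}\ge 2$ or $=\infty$ for $s\ne t$. Associate to it a symmetric matrix $B$ with $B_{st}=-\cos(\pi/m_{st})$ if $m_{st}<\infty$ and $B_{st}=-c_{st}$ if $m_{st}=\infty$, where the $c_{st}=c_{ts}\ge 1$ are arbitrarily chosen. The pair is a geometric Coxeter system, denoted $(W,S)_B$. Let $V$ be a real vector space with basis $\Delta=\{\alpha_s\}_{s\in S}$ (simple roots) and bilinear form $\mathcal B(\alpha_s,\alpha_t)=B_{st}$. $W$ acts faithfully on $V$, with $s\in S$ acting as the reflection $\mathbf x\mapsto \mathbf x-2\frac{\mathcal B(\mathbf x,\alpha_s)}{\mathcal B(\alpha_s,\alpha_s)}\alpha_s$; write $w(\mathbf x)$ for the action. The system is Lorentzian if $\mathcal B$ has signature $(n-1,1)$. $\mathbb{P}V$ is the projective space of $1$-dimensional subspaces of $V$ with its usual topology; for $\mathbf x\in V\setminus\{0\}$, $\widehat{\mathbf x}\in\mathbb{P}V$ is the line spanned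 by $\mathbf x$. $W$ acts on $\mathbb{P}V$ by $w\cdot\widehat{\mathbf x}=\widehat{w(\mathbf x)}$. The projective light cone is $\widehat Q=\{\widehat{\mathbf x}\in\mathbb{P}V:\mathcal B(\mathbf x,\mathbf x)=0\}$. A limit direction is a limit in $\mathbb{P}V$ of an injective sequence of points in a $W$-orbit $W\cdot\widehat{\mathbf x}_0$. The roots are $\Phi=W(\Delta)$; a limit root is a point $\widehat{\mathbf x}\in\mathbb{P}V$ for which there is an injective sequence $(\gamma_i)$ in $\Phi$ with $\widehat{\gamma_i}\to\widehat{\mathbf x}$. *)

(* Defs.v *)
From HB Require Import structures.
From mathcomp Require Import all_boot all_order all_algebra.
From mathcomp Require Import all_classical all_reals all_analysis.

Set Implicit Arguments.
Unset Strict Implicit.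
Unset Printing Implicit Defensive.

Import Order.TTheory GRing.Theory Num.Theory.
Import numFieldNormedType.Exports.

Local Open Scope classical_set_scope.
Local Open Scope ring_scope.

(* [None] stands for infinity. *)
Definition coxeter_mx (n : nat) := 'I_n -> 'I_n -> option nat.

Record is_coxeter_mx (n : nat) (m : coxeter_mx n) : Prop := IsCoxeterMx {
  coxeter_mx_diag : forall i, m i i = Some 1%N;
  coxeter_mx_sym : forall i j, m i j = m j i;
  coxeter_mx_off : forall i j k, i != j -> m i j = Some k -> (2 <= k)%N }.

Definition coxeter_relations (n : nat) (m : coxeter_mx n) (G : groupType)
    (f : 'I_n -> G) : Prop :=
  forall i j k, m i j = Some k -> ((f i * f j) ^+ k = 1)%g.

(* The set S is enumerated by the injection [s]; the last two fields say that
   W is the group presented by S and the relations [m]. *)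
Record is_coxeter_system (n : nat) (W : groupType) (s : 'I_n -> W)
    (m : coxeter_mx n) : Prop := IsCoxeterSystem {
  coxeter_matrix : is_coxeter_mx m;
  coxeter_gen_inj : injective s;
  coxeter_rel : coxeter_relations m s;
  coxeter_gen : forall P : W -> Prop,
    (forall i, P (s i)) -> P 1%g ->
    (forall u v, P u -> P v -> P (u * v)%g) -> (forall u, P u -> P (u^-1)%g) ->
    forall w, P w;
  coxeter_univ : forall (G : groupType) (f : 'I_n -> G),
    coxeter_relations m f ->
    exists phi : {multiplicative W -> G}, forall i, phi (s i) = f i }.

Definition weights_ok (R : realType) (n : nat) (m : coxeter_mx n)
    (c : 'M[R]_n) : Prop :=
  forall i j, m i j = None -> 1 <= c i j /\ c i j = c j i.

Definition gram_mx (R : realType) (n : nat) (m : coxeter_mx n)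
    (c : 'M[R]_n) : 'M[R]_n :=
  \matrix_(i, j) if m i j is Some k then - cos (pi / k%:R) else - c i j.

Definition bform (R : realType) (n : nat) (B : 'M[R]_n) (x y : 'cV[R]_n) : R :=
  (x^T *m B *m y) ord0 ord0.

(* The rows of P form an orthogonal basis with p positive and q negative
   vectors; by Sylvester's law of inertia p and q depend on B only. *)
Definition has_signature (R : realType) (n : nat) (B : 'M[R]_n)
    (p q : nat) : Prop :=
  exists P : 'M[R]_n,
    let D := P *m B *m P^T in
    [/\ P \in unitmx, is_diag_mx D,
        #|[set i | 0 < D i i]%SET| = p & #|[set i | D i i < 0]%SET| = q].

Definition lorentzian (R : realType) (n : nat) (B : 'M[R]_n) : Prop :=
  has_signature B n.-1 1.

(* V is R^n and the simple roots are its standard basis. *)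
Definition simple_root (R : realType) (n : nat) (i : 'I_n) : 'cV[R]_n :=
  delta_mx i ord0.

Definition reflection (R : realType) (n : nat) (B : 'M[R]_n)
    (a x : 'cV[R]_n) : 'cV[R]_n :=
  x - (2 * (bform B x a / bform B a a)) *: a.

(* The linear action of W on V; it is unique because W is generated by s. *)
Record geometric_action (R : realType) (n : nat) (W : groupType)
    (s : 'I_n -> W) (B : 'M[R]_n) := GeometricAction {
  act_mx :> W -> 'M[R]_n;
  act_mx1 : act_mx 1%g = 1%:M;
  act_mxM : forall u v, act_mx (u * v)%g = act_mx u *m act_mx v;
  act_mx_gen : forall i x, act_mx (s i) *m x = reflection B (simple_root R i) x }.

(* V \ {0}, with the subspace topology that [set_type] carries. *)
Definition nzvec (R : realType) (n : nat) : Type :=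
  set_type [set x : 'cV[R]_n | x != 0].
HB.instance Definition _ (R : realType) (n : nat) :=
  Topological.copy (nzvec R n) (set_type [set x : 'cV[R]_n | x != 0]).

Lemma nzvec_neq0 (R : realType) (n : nat) (x : nzvec R n) : val x != 0.
Proof. by have /set_mem := valP x. Qed.

Definition mk_nzvec (R : realType) (n : nat) (x : 'cV[R]_n) (h : x != 0) :
  nzvec R n := exist _ x (mem_set h).

Record line (R : realType) (n : nat) := Line {
  line_vs :> {vspace 'cV[R]_n};
  line_dim : \dim line_vs == 1%N }.
HB.instance Definition _ (R : realType) (n : nat) :=
  [isSub for @line_vs R n].
HB.instance Definition _ (R : realType) (n : nat) :=
  [Choice of line R n by <:].

Section Projective.
Variables (R : realType) (n : nat).

Lemma dim_line_of (x : nzvec R n) : \dim <[val x]>%VS == 1%N.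
Proof. by rewrite dim_vline nzvec_neq0. Qed.

Definition line_of (x : nzvec R n) : line R n := Line (dim_line_of x).

Lemma line_vpick_neq0 (L : line R n) : vpick L != 0.
Proof. by rewrite vpick0 -dimv_eq0 (eqP (line_dim L)). Qed.

Definition line_repr (L : line R n) : nzvec R n := mk_nzvec (line_vpick_neq0 L).

Lemma line_reprK : cancel line_repr line_of.
Proof.
move=> L; apply/val_inj/eqP => /=.
by rewrite eqEdim -memvE memv_pick (eqP (line_dim L)) dim_vline line_vpick_neq0.
Qed.

HB.instance Definition _ :=
  isQuotient.Build (nzvec R n) (line R n) line_reprK.

Definition projspace : Type := quotient_topology (line R n).

Definition hat (x : nzvec R n) : projspace := line_of x.

Lemma hatE : hat = (\pi_(projspace))%qT.
Proof. by rewrite pi.unlock. Qed.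

Lemma hatP (x y : nzvec R n) :
  hat x = hat y <-> exists2 a, a != 0 & val x = a *: val y.
Proof.
split=> [/(congr1 (@line_vs R n)) /= e | [a a0 e]].
  have /vlineP[a xE] : val x \in <[val y]>%VS by rewrite -e memv_line.
  exists a => //; apply: contraTneq (nzvec_neq0 x) => a0.
  by rewrite xE a0 scale0r eqxx.
apply: (@val_inj _ _ (line R n)); rewrite /= e.
apply: subv_anti; rewrite -!memvE memvZ ?memv_line //=.
by rewrite -[X in X \in _](scalerK a0) memvZ ?memv_line.
Qed.

Lemma open_projspace (U : set projspace) : open U <-> open (hat @^-1` U).
Proof. by rewrite hatE. Qed.

End Projective.
Arguments hat {R n} x.

Section Limits.
Variables (R : realType) (n : nat) (W : groupType) (s : 'I_n -> W).
Variables (B : 'M[R]_n) (rho : geometric_action s B).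

Lemma act_neq0 (w : W) (x : 'cV[R]_n) : x != 0 -> rho w *m x != 0.
Proof.
apply: contra_neq => e.
by rewrite -[x]mul1mx -(act_mx1 rho) -(mulVg w) act_mxM -mulmxA e mulmx0.
Qed.

Definition act_nz (w : W) (x : nzvec R n) : nzvec R n :=
  mk_nzvec (act_neq0 w (nzvec_neq0 x)).

Lemma act_line_dim (w : W) (L : line R n) :
  \dim (linfun (mulmx (rho w)) @: L)%VS == 1%N.
Proof.
have -> : line_vs L = <[vpick L]>%VS by rewrite -{1}[L]line_reprK.
by rewrite limg_line dim_vline lfunE act_neq0 // line_vpick_neq0.
Qed.

Definition act_proj (w : W) (L : projspace R n) : projspace R n :=
  Line (act_line_dim w L).

Lemma act_proj_hat (w : W) (x : nzvec R n) :
  act_proj w (hat x) = hat (act_nz w x).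
Proof.
by apply: (@val_inj _ _ (line R n)); rewrite /= limg_line lfunE.
Qed.

Definition light_cone : set (projspace R n) :=
  [set L | exists2 x : nzvec R n, L = hat x & bform B (val x) (val x) = 0].

Definition orbit_proj (L : projspace R n) : set (projspace R n) :=
  [set act_proj w L | w in [set: W]].

Definition limit_direction (L : projspace R n) : Prop :=
  exists (x0 : nzvec R n) (p : nat -> projspace R n),
    [/\ injective p, forall k, orbit_proj (hat x0) (p k) & p @ \oo --> L].

Lemma simple_root_neq0 (i : 'I_n) : simple_root R i != 0.
Proof.
apply/eqP => /matrixP/(_ i ord0)/eqP.
by rewrite !mxE !eqxx oner_eq0.
Qed.

Definition roots : set (nzvec R n) :=
  [set g | exists w i, g = act_nz w (mk_nzvec (simple_root_neq0 i))].

Definition limit_root (L : projspace R n) : Prop :=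
  exists g : nat -> nzvec R n,
    [/\ injective g, forall k, roots (g k) & hat \o g @ \oo --> L].

End Limits.

(* Main.v *)
Require Import Defs.
From HB Require Import structures.
From mathcomp Require Import all_boot all_order all_algebra.
From mathcomp Require Import ring lra zify.
From mathcomp Require Import all_classical all_reals all_analysis.

Set Implicit Arguments.
Unset Strict Implicit.
Unset Printing Implicit Defensive.

Import Order.TTheory GRing.Theory Num.Theory.
Import numFieldNormedType.Exports.
Local Open Scope classical_set_scope.
Local Open Scope ring_scope.

(** Write [B] for the Gram form and let [e] span the limit line, so that
    [B(e, e) = 0] and suitable multiples of the vectors [w_k x0] tend to [e].
    Isotropic lines of a Lorentzian form that are orthogonal are equal; the
    quantitative version is that a root [g], for which [B(g, g) = 1], has a
    direction close to that of [e] as soon as [|g|] is large and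
    [B(e, g) / |g|] is small. So it is enough to find, at every scale, roots
    that are long and almost orthogonal to [e] in this sense; this property of
    [e] is [root_asymptotic], and [limit_root_asymptotic] turns it into a limit
    root. It is a closed condition on [e], invariant under [W] and scaling.

    Let [a_k w_k x0] tend to [e]. If [a_k] stays bounded along a subsequence,
    the roots [w_k alpha_i] do the job: [B(w_k x0, w_k alpha_i)] does not depend
    on [k], hence [B(e, w_k alpha_i)] is small compared with [|w_k alpha_i|],
    provided that some [w_k alpha_i] is long ([root_asymptotic_bounded]). If
    [a_k] is unbounded, [w_k x0] comes close to [0], so [w_k^-1] expands a lot,
    and the roots [w_k^-1 alpha_i] are long and almost orthogonal to [x0],
    because [B(x0, w_k^-1 alpha_i) = B(w_k x0, alpha_i)] is small
    ([root_asymptotic_base]). Then [x0] itself has the property, hence so do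
    the vectors [w_k x0] and their limit [e].

    The first case needs that the matrices of distinct elements [w_k] leave
    every bounded set, that is, that [W] acts discretely
    ([act_norm_escapes]). This comes from the Coxeter structure: an element
    that is not lengthened by [s_a] on the right sends [alpha_a] to a vector
    with nonpositive coordinates, so no element other than [1] is close to the
    identity matrix ([act_diag_le0]). The positivity of roots behind this,
    [ascent_nonneg], is proved by induction on length from rank two. *)

(** * The action preserves the Gram form *)

Section GramAction.
Variables (R : realType) (n : nat) (W : groupType) (s : 'I_n -> W).
Variables (m : coxeter_mx n) (c : 'M[R]_n).
Hypotheses (hW : is_coxeter_system s m) (hc : weights_ok m c).
Variable rho : geometric_action s (gram_mx m c).

Local Notation B := (gram_mx m c).
Local Notation alpha := (@simple_root R n).

Lemma bformDl (x y z : 'cV[R]_n) : bform B (x + y) z = bform B x z + bform B y z.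
Proof. by rewrite /bform linearD !mulmxDl mxE. Qed.

Lemma bformZl (a : R) (x y : 'cV[R]_n) : bform B (a *: x) y = a * bform B x y.
Proof. by rewrite /bform linearZ -!scalemxAl mxE. Qed.

Lemma gram_sym i j : B i j = B j i.
Proof.
rewrite !mxE (coxeter_mx_sym (coxeter_matrix hW) j i).
by case E: (m i j) => [k|] //; have [_ ->] := hc E.
Qed.

Lemma gram_tr : B^T = B.
Proof. by apply/matrixP => i j; rewrite mxE gram_sym. Qed.

Lemma gram_diag i : B i i = 1.
Proof.
by rewrite mxE (coxeter_mx_diag (coxeter_matrix hW)) divr1 cospi opprK.
Qed.

Lemma bformC (x y : 'cV[R]_n) : bform B x y = bform B y x.
Proof.
rewrite /bform; have -> : x^T *m B *m y = (y^T *m B *m x)^T.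
  by rewrite !trmx_mul trmxK gram_tr mulmxA.
by rewrite mxE.
Qed.

Lemma bform_simple i j : bform B (alpha i) (alpha j) = B i j.
Proof.
by rewrite /bform /simple_root trmx_delta -rowE -colE !mxE.
Qed.

Lemma act_simple i j : rho (s i) *m alpha j = alpha j - (2 * B i j) *: alpha i.
Proof.
by rewrite act_mx_gen /reflection !bform_simple gram_diag divr1 gram_sym.
Qed.

Lemma gen_sq i : (s i * s i = 1)%g.
Proof.
by have := coxeter_rel hW (coxeter_mx_diag (coxeter_matrix hW) i); rewrite expg1.
Qed.

Lemma gen_inv i : ((s i)^-1 = s i)%g.
Proof. by apply: (mulgI (s i)); rewrite gen_sq mulgV. Qed.

Lemma bform_act_gen i x y :
  bform B (rho (s i) *m x) (rho (s i) *m y) = bform B x y.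
Proof.
have rE z : rho (s i) *m z = z + (- (2 * bform B z (alpha i))) *: alpha i.
  by rewrite act_mx_gen /reflection bform_simple gram_diag divr1 scaleNr.
rewrite !rE bformDl bformZl ![bform B _ (y + _)]bformC !bformDl !bformZl.
rewrite bform_simple gram_diag [bform B (alpha i) x]bformC (bformC y x).
ring.
Qed.

Lemma bform_act w x y : bform B (rho w *m x) (rho w *m y) = bform B x y.
Proof.
move: w x y; apply: (coxeter_gen hW) => [i x y|x y|u v hu hv x y|u hu x y].
- exact: bform_act_gen.
- by rewrite act_mx1 !mul1mx.
- by rewrite act_mxM -!mulmxA hu hv.
- by rewrite -[LHS]hu !mulmxA -!act_mxM mulgV act_mx1 !mul1mx.
Qed.

End GramAction.

(** * Length and alternating words *)

Section Length.
Variables (n : nat) (W : groupType) (s : 'I_n -> W).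
Hypothesis gen_s : forall P : W -> Prop,
  (forall i, P (s i)) -> P 1%g ->
  (forall u v, P u -> P v -> P (u * v)%g) -> (forall u, P u -> P (u^-1)%g) ->
  forall w, P w.
Hypothesis s_inv : forall i, ((s i)^-1 = s i)%g.

Fixpoint word (l : seq 'I_n) : W :=
  if l is i :: l' then (s i * word l')%g else 1%g.

Lemma word_cat l1 l2 : word (l1 ++ l2) = (word l1 * word l2)%g.
Proof. by elim: l1 => [|i l1 /= ->]; rewrite ?mul1g ?mulgA. Qed.

Lemma word_ex w : exists l, word l = w.
Proof.
move: w; apply: gen_s => [i||u v [l1 <-] [l2 <-]|u [l <-]].
- by exists [:: i]; rewrite /= mulg1.
- by exists [::].
- by exists (l1 ++ l2); rewrite word_cat.
- exists (rev l); elim: l => [|i l IHl] /=; first by rewrite invg1.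
  by rewrite rev_cons -cats1 word_cat IHl /= mulg1 invgM s_inv.
Qed.

Lemma word_size_ex w : exists k, `[< exists2 l, size l = k & word l = w >].
Proof. by have [l lw] := word_ex w; exists (size l); apply/asboolP; exists l. Qed.

Definition len w := ex_minn (word_size_ex w).

Lemma len_word l : (len (word l) <= size l)%N.
Proof.
by rewrite /len; case: ex_minnP => k _; apply; apply/asboolP; exists l.
Qed.

Lemma reduced_word w : exists2 l, size l = len w & word l = w.
Proof. by rewrite /len; case: ex_minnP => k /asboolP. Qed.

Lemma lenM u v : (len (u * v) <= len u + len v)%N.
Proof.
have [l1 <- e1] := reduced_word u; have [l2 <- e2] := reduced_word v.
by rewrite -{1}e1 -{1}e2 -word_cat -size_cat len_word.
Qed.

Lemma len_gen i : (len (s i) <= 1)%N.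
Proof. by rewrite -[s i]mulg1; exact: (len_word [:: i]). Qed.

Lemma mulgsK w i : (w * s i * s i = w)%g.
Proof. by rewrite -mulgA -{1}s_inv mulVg mulg1. Qed.

(** Remove the last letter of a reduced word. *)
Lemma descent_ex w : w != 1%g -> exists i, (len (w * s i)%g < len w)%N.
Proof.
have [l <- <-] := reduced_word w.
case/lastP: l => [|l i _]; first by rewrite eqxx.
exists i; rewrite size_rcons ltnS -cats1 word_cat /= mulg1 mulgsK.
exact: len_word.
Qed.

(** The product of the last [j] letters of the word [... a b a b]. Fixing the
    right end makes the right factors of such a product products of the same
    kind. *)
Fixpoint alt (a b : 'I_n) (j : nat) : W :=
  if j is j'.+1 then (s (if odd j' then a else b) * alt a b j')%g else 1%g.

Lemma altSr a b j : alt a b j.+1 = (alt b a j * s b)%g.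
Proof.
elim: j => [|j IHj]; first by rewrite /= mulg1 mul1g.
by rewrite [LHS]/= -/(alt a b j.+1) IHj mulgA /=; case: (odd j).
Qed.

Lemma alt_double a b h : alt a b h.*2 = ((s a * s b) ^+ h)%g.
Proof.
elim: h => [|h IHh] //.
by rewrite doubleS /= odd_double -/(alt a b h.*2) IHh mulgA expgS.
Qed.

(** The relation [(s_a s_b) ^ k = 1] read as a braid relation: both sides have
    length [k]. *)
Lemma alt_braid a b k : ((s a * s b) ^+ k = 1)%g -> alt a b k = alt b a k.
Proof.
move=> abk; have invE h : ((s b * s a) ^+ h = ((s a * s b) ^+ h)^-1)%g.
  by rewrite -expVgn invgM !s_inv.
case: (boolP (odd k)) => [ok|ek]; last first.
  rewrite -(even_halfK ek) !alt_double invE.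
  apply: (mulgI ((s a * s b) ^+ k./2)%g).
  by rewrite mulgV -expgnDr addnn even_halfK.
have kE : k = (k./2).*2.+1 by rewrite -[LHS]odd_double_half ok.
(* After multiplication by [s b], the odd case compares even products. *)
apply: (mulIg (s b)); rewrite kE {1}altSr alt_double mulgsK invE.
have -> : alt b a (k./2).*2.+1 = (s a * alt b a (k./2).*2)%g.
  by rewrite /= odd_double.
have -> : (s a * alt b a (k./2).*2 * s b = alt a b (k./2).+1.*2)%g.
  by rewrite -mulgA -altSr doubleS [RHS]/= -/(alt a b (k./2).*2.+1) /= odd_double.
apply: (mulgI ((s a * s b) ^+ k./2)%g).
by rewrite mulgV alt_double -expgnDr addnS addnn -kE.
Qed.

Lemma len_alt_suffix a b p q :
  exists2 x, alt a b (p + q) = (x * alt a b q)%g & (len x <= p)%N.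
Proof.
elim: p => [|p [x e lx]].
  by exists 1%g; rewrite ?mul1g //; exact: (len_word [::]).
exists (s (if odd (p + q) then a else b) * x)%g; first by rewrite /= e mulgA.
by apply: leq_trans (lenM _ _) _; rewrite -add1n leq_add ?len_gen.
Qed.

Lemma len_alt a b j : (len (alt a b j) <= j)%N.
Proof. by have [x + ?] := len_alt_suffix a b j 0; rewrite addn0 mulg1 => ->. Qed.

End Length.

(** * Positivity of roots *)

Section DihedralCoefficients.
Variable R : realType.

(** Chebyshev polynomials of the second kind, shifted by one: they are the
    coefficients of the orbit of a simple root under a dihedral group whose
    Gram entry is [- c]. *)
Fixpoint cheb (c : R) (j : nat) : R :=
  if j is j'.+1 then
    if j' is j''.+1 then 2 * c * cheb c j' - cheb c j'' else 1
  else 0.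

Lemma chebSS c j : cheb c j.+2 = 2 * c * cheb c j.+1 - cheb c j.
Proof. by []. Qed.

Lemma sin_cheb t j : sin t * cheb (cos t) j = sin (t *+ j).
Proof.
suff [] : sin t * cheb (cos t) j = sin (t *+ j) /\
  sin t * cheb (cos t) j.+1 = sin (t *+ j.+1) by [].
elim: j => [|j [IH1 IH2]]; first by rewrite mulr0n mulr1n sin0 mulr0 mulr1.
split=> //; rewrite chebSS mulrBr mulrCA IH1 IH2.
have -> : t *+ j.+2 = t *+ j.+1 + t by rewrite mulrSr.
have -> : t *+ j = t *+ j.+1 - t by rewrite mulrSr addrK.
by rewrite sinB sinD; ring.
Qed.

(** [sin (j pi / k)] is nonnegative for [j <= k], the range of lengths in the
    dihedral group of order [2 k]. *)
Lemma cheb_ge0_finite k j : (2 <= k)%N -> (j <= k)%N ->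
  0 <= cheb (cos (pi / k%:R)) j.
Proof.
move=> k2 jk; set t : R := pi / k%:R.
have k0 : 0 < k%:R :> R by rewrite ltr0n; lia.
have pi0 : 0 < pi :> R := pi_gt0 R.
have t0 : 0 < t by rewrite divr_gt0.
have tpi : t < pi by rewrite ltr_pdivrMr // ltr_pMr // ltr1n.
have sin0 : 0 < sin t by rewrite sin_gt0_pi // t0.
rewrite -(pmulr_rge0 _ sin0) sin_cheb sin_ge0_pi //.
rewrite mulrn_wge0 ?(ltW t0) //= -mulr_natr /t mulrAC ler_pdivrMr //.
by rewrite ler_pM2l // ler_nat.
Qed.

Lemma cheb_ge0_infinite c j : 1 <= c -> 0 <= cheb c j.
Proof.
move=> c1; suff [] : 0 <= cheb c j /\ cheb c j <= cheb c j.+1 by [].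
elim: j => [|j [IH1 IH2]]; first by rewrite /= ler01.
by rewrite chebSS; split; nra.
Qed.

End DihedralCoefficients.

Section Positivity.
Variables (R : realType) (n : nat) (W : groupType) (s : 'I_n -> W).
Variables (m : coxeter_mx n) (c : 'M[R]_n).
Hypotheses (hW : is_coxeter_system s m) (hc : weights_ok m c).
Variable rho : geometric_action s (gram_mx m c).

Local Notation B := (gram_mx m c).
Local Notation alpha := (@simple_root R n).
Local Notation len := (len (coxeter_gen hW) (gen_inv hW)).

(** The leftmost letter of the word is [b] for odd [j] and [a] for even [j > 0];
    its root carries the larger index. *)
Lemma act_alt a b j : rho (alt s a b j) *m alpha a =
  cheb (- B a b) (if odd j then j else j.+1) *: alpha a +
  cheb (- B a b) (if odd j then j.+1 else j) *: alpha b.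
Proof.
pose alt_act a b j := rho (alt s a b j) *m alpha a =
  cheb (- B a b) (if odd j then j else j.+1) *: alpha a +
  cheb (- B a b) (if odd j then j.+1 else j) *: alpha b.
suff [] : (forall a b, alt_act a b j) /\ (forall a b, alt_act a b j.+1).
  by move=> + _; apply.
elim: j => [|j [IH1 IH2]]; split=> // {}a {}b; rewrite /alt_act.
- by rewrite /= act_mx1 mul1mx scale0r addr0 scale1r.
- rewrite /= mulg1 (act_simple hW hc) (gram_sym hW hc b a) scale1r.
  by rewrite mulr1 subr0 mulrN scaleNr.
rewrite altSr act_mxM -mulmxA (act_simple hW hc) (gram_sym hW hc b a).
rewrite mulmxBr -scalemxAr (IH2 b a) altSr act_mxM -mulmxA (act_simple hW hc).
rewrite (gram_diag _ hW) mulr1 scaler_nat mulr2n opprD addNKr mulmxN (IH1 a b).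
rewrite (gram_sym hW hc b a) [odd j.+2]/= negbK oddS.
move: (alpha a) (alpha b) (B a b) => u v x.
by case: (odd j); apply/matrixP => i l; rewrite !mxE ?chebSS; ring.
Qed.

Definition nonneg_vec (v : 'cV[R]_n) := forall i, 0 <= v i ord0.

Lemma cheb_gram_ge0 a b j : a != b ->
  (forall k, m a b = Some k -> (j <= k)%N) -> 0 <= cheb (- B a b) j.
Proof.
move=> ab jk; rewrite mxE; case E: (m a b) => [k|]; rewrite opprK.
  apply: cheb_ge0_finite; last exact: jk.
  exact: (coxeter_mx_off (coxeter_matrix hW) ab E).
by apply: cheb_ge0_infinite; have [] := hc E.
Qed.

Lemma alt_act_nonneg w a b j : a != b ->
  (forall k, m a b = Some k -> (j < k)%N) ->
  nonneg_vec (rho w *m alpha a) -> nonneg_vec (rho w *m alpha b) ->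
  nonneg_vec (rho (w * alt s a b j)%g *m alpha a).
Proof.
move=> ab jk wa wb i; rewrite act_mxM -mulmxA act_alt mulmxDr -!scalemxAr.
have cheb0 l : (l <= j.+1)%N -> 0 <= cheb (- B a b) l.
  by move=> lj; apply: cheb_gram_ge0 => // k /jk; apply: leq_trans.
rewrite [X in 0 <= X]mxE [X in 0 <= X + _]mxE [X in 0 <= _ + X]mxE.
by apply: addr_ge0; apply: mulr_ge0 => //; apply: cheb0; case: (odd j).
Qed.

(** Let [b] be a descent of [w], and write [w = v u] with lengths adding up,
    [u] an alternating word in [a] and [b], and [v] as short as possible.
    Then neither [a] nor [b] is a descent of [v], so [v] keeps [alpha_a] and
    [alpha_b] nonnegative by induction. The word [u] ends in [b] and is shorter
    than the order of [s_a s_b], otherwise a braid move would make [a] a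
    descent of [w]; so [u] sends [alpha_a] to a nonnegative combination of
    [alpha_a] and [alpha_b]. *)
Lemma ascent_nonneg w a :
  (len w <= len (w * s a)%g)%N -> nonneg_vec (rho w *m alpha a).
Proof.
have [N] := ubnP (len w); elim: N w a => // N IHN w a; rewrite ltnS => wN wa.
have [w1|w1] := eqVneq w 1%g.
  by rewrite w1 act_mx1 mul1mx => i; rewrite !mxE; case: (_ && _).
have [b wb] := descent_ex (coxeter_gen hW) (gen_inv hW) w1.
have ab : a != b by apply: contraTneq wb => <-; rewrite -leqNgt.
(* Factorizations [w = v u] with [u] nonempty and [len v = d]. *)
pose fact d := exists v j,
  [/\ len v = d, w = (v * alt s a b j.+1)%g & len w = (d + j.+1)%N].
have exfact : exists d, `[< fact d >].
  exists (len (w * s b)%g); apply/asboolP; exists (w * s b)%g, 0%N.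
  have wE : w = (w * s b * s b)%g by rewrite (mulgsK (gen_inv hW)).
  split=> //; first by rewrite /= mulg1.
  apply/eqP; rewrite eqn_leq addn1 wb andbT {1}wE.
  have := lenM (coxeter_gen hW) (gen_inv hW) (w * s b)%g (s b).
  have := len_gen (coxeter_gen hW) (gen_inv hW) b; lia.
case: (ex_minnP exfact) => d /asboolP[v [j [vd wE lw]]] dmin.
have altlen k := len_alt (coxeter_gen hW) (gen_inv hW) a b k.
have lenMle := lenM (coxeter_gen hW) (gen_inv hW).
have ascent_v e : (len v <= len (v * s (if odd j (+) e then a else b))%g)%N.
  rewrite leqNgt; apply/negP; set v' := (v * _)%g => lt_v.
  (* Either [v'] absorbs the first letter of [u], and [w] gets shorter, or [u]
     takes the other letter from [v], against the minimality of [d]. *)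
  case: e @v' lt_v => v' lt_v.
    have wE' : w = (v' * alt s a b j.+2)%g.
      rewrite wE -!mulgA; congr (_ * _)%g.
      by rewrite [in RHS]/= mulgA -addbT (gen_sq hW) mul1g.
    have := lenMle v' (alt s a b j.+2); rewrite -wE' => le_w.
    have le_alt := altlen j.+2.
    have : (d <= len v')%N.
      by apply: dmin; apply/asboolP; exists v', j.+1; split=> //; lia.
    by lia.
  have wE' : w = (v' * alt s a b j)%g by rewrite wE /v' addbF /= mulgA.
  by have := lenMle v' (alt s a b j); rewrite -wE'; have := altlen j; lia.
have [va vb] : (len v <= len (v * s a)%g)%N /\ (len v <= len (v * s b)%g)%N.
  by move: (ascent_v true) (ascent_v false); case: (odd j).
rewrite wE; apply: alt_act_nonneg => //; try by apply: IHN => //; lia.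
move=> k mk; rewrite ltnNge; apply/negP => kj.
have k2 : (2 <= k)%N := coxeter_mx_off (coxeter_matrix hW) ab mk.
(* The last [k] letters of [u] can be replaced by the alternating word that
   ends in [a], which cancels in [w s_a]. *)
have [x xE lx] := len_alt_suffix (coxeter_gen hW) (gen_inv hW) a b (j.+1 - k) k.
have wsaE : (w * s a = v * x * alt s a b k.-1)%g.
  rewrite wE -{1}(subnK kj) xE (alt_braid (gen_inv hW)) ?(coxeter_rel hW) //.
  by rewrite -(prednK (ltnW k2)) altSr !mulgA (mulgsK (gen_inv hW)).
have := lenMle (v * x)%g (alt s a b k.-1); have := lenMle v x.
by rewrite -wsaE; have := altlen k.-1; lia.
Qed.

(** The gap that makes [W] discrete: at a descent [a] of [w], [w s_a] keeps
    [alpha_a] nonnegative, hence [w] makes it nonpositive, while the identity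
    matrix has diagonal entry [1]. *)
Lemma act_diag_le0 w : w != 1%g -> exists a, rho w a a <= 0.
Proof.
move=> /(descent_ex (coxeter_gen hW) (gen_inv hW))[a wa]; exists a.
have : nonneg_vec (rho (w * s a)%g *m alpha a).
  by apply: ascent_nonneg; rewrite (mulgsK (gen_inv hW)) ltnW.
move=> /(_ a); rewrite act_mxM -mulmxA (act_simple hW hc) (gram_diag _ hW).
rewrite mulr1 scaler_nat mulr2n opprD addNKr mulmxN mxE oppr_ge0.
by rewrite /simple_root -colE mxE.
Qed.

End Positivity.

(** * Matrix norms and the Lorentzian form *)

Section MatrixNorm.
Variable R : realType.

Lemma ler_mx_entry p q (A : 'M[R]_(p, q)) i j : `|A i j| <= `|A|.
Proof.
rewrite [leRHS]/Num.norm /= mx_normrE.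
exact: (le_bigmax _ (fun ij : 'I_p * 'I_q => `|A ij.1 ij.2|) (i, j)).
Qed.

Lemma mx_norm_le p q (A : 'M[R]_(p, q)) K : 0 <= K ->
  (forall i j, `|A i j| <= K) -> `|A| <= K.
Proof.
move=> K0 AK; rewrite [leLHS]/Num.norm /= mx_normrE.
by apply/bigmax_leP; split=> // -[i j] _; exact: AK.
Qed.

Lemma mx_norm_attained p q (A : 'M[R]_(p, q)) : A != 0 ->
  exists ij : 'I_p * 'I_q, `|A| = `|A ij.1 ij.2|.
Proof. by rewrite -normr_eq0; exact: mx_norm_neq0. Qed.

Lemma mx_norm_mul p q r (A : 'M[R]_(p, q)) (C : 'M[R]_(q, r)) :
  `|A *m C| <= q%:R * `|A| * `|C|.
Proof.
apply: mx_norm_le => [|i j]; first by rewrite !mulr_ge0.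
rewrite mxE; apply: le_trans (ler_norm_sum _ _ _) _.
rewrite -mulrA mulr_natl -[X in _ *+ X]card_ord -sumr_const.
by apply: ler_sum => k _; rewrite normrM ler_pM // ler_mx_entry.
Qed.

Lemma mx_norm_tr p q (A : 'M[R]_(p, q)) : `|A^T| = `|A|.
Proof.
have le r t (C : 'M[R]_(r, t)) : `|C^T| <= `|C|.
  by apply: mx_norm_le => // i j; rewrite mxE ler_mx_entry.
by apply/le_anti; rewrite le /= -{1}[A]trmxK le.
Qed.

Lemma bform_bounded n (B : 'M[R]_n) :
  exists2 C, 0 < C & forall x y, `|bform B x y| <= C * `|x| * `|y|.
Proof.
exists (n%:R * (n%:R * `|B|) + 1) => [|x y]; first by rewrite ltr_wpDl ?mulr_ge0.
apply: le_trans (ler_mx_entry _ _ _) _.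
apply: le_trans (mx_norm_mul _ _) _; rewrite ler_wpM2r //.
have := mx_norm_mul x^T B; rewrite mx_norm_tr => /(ler_wpM2l (ler0n R n)).
by have := normr_ge0 x; nra.
Qed.

(** Pigeonhole: a bounded set of matrices meets finitely many cells of a
    grid of mesh smaller than the separation. *)
Lemma separated_bounded_finite p q (F : nat -> 'M[R]_(p, q)) (S : set nat) M d :
  0 < d -> (forall k, S k -> `|F k| <= M) ->
  (forall k l, S k -> S l -> k != l -> d <= `|F k - F l|) ->
  exists N, forall k, S k -> (k < N)%N.
Proof.
move=> d0 FM Fd.
have d2 : 0 < 2 / d by rewrite divr_gt0.
pose x k ij := (F k ij.1 ij.2 + M) * (2 / d).
pose cell k : {ffun 'I_p * 'I_q -> 'I_(Num.trunc ((M + M) * (2 / d))).+1} :=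
  [ffun ij => inord (Num.trunc (x k ij))].
have x_ge0 k ij : S k -> 0 <= F k ij.1 ij.2 + M <= M + M.
  move=> /FM; have := ler_mx_entry (F k) ij.1 ij.2.
  by rewrite ler_norml => /andP[? ?] ?; lra.
have cell_inj k l : S k -> S l -> cell k = cell l -> k = l.
  move=> Sk Sl /ffunP ckl; apply/eqP; apply: contraT => kl.
  have : `|F k - F l| < d; last by rewrite ltNge Fd.
  apply: (@le_lt_trans _ _ (d / 2)); last by rewrite ltr_pdivrMr // ltr_pMr // ltr1n.
  apply: mx_norm_le => [|i j]; first by rewrite divr_ge0 // ltW.
  have /(congr1 (@nat_of_ord _)) := ckl (i, j); rewrite !ffunE.
  have /andP[k0 k1] := x_ge0 k (i, j) Sk; have /andP[l0 l1] := x_ge0 l (i, j) Sl.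
  rewrite !inordK ?ltnS ?le_truncn ?ler_pM2r // => xkl.
  have := truncn_itv (mulr_ge0 k0 (ltW d2)).
  have := truncn_itv (mulr_ge0 l0 (ltW d2)).
  rewrite -/(x k (i, j)) -/(x l (i, j)) xkl -natr1 !mxE /x /=.
  move=> /andP[l2 l3] /andP[k2 k3].
  have -> : F k i j - F l i j = (F k i j + M) - (F l i j + M) by ring.
  rewrite -(ler_pM2r d2) -[X in _ * X <= _](gtr0_norm d2) -normrM mulrBl.
  have -> : d / 2 * (2 / d) = 1 by field; rewrite gt_eqF.
  by rewrite ler_norml; apply/andP; split; lra.
pose cellS k := if k \in S then Some (cell k) else None.
have /finite_seqP[t tE] : finite_set S.
  have -> : S = cellS @^-1` [set~ None].
    apply/seteqP; split=> k; rewrite /cellS /=; first by move=> /mem_set ->.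
    by case: ifPn => // /set_mem.
  apply: finite_preimage; last exact: finite_finset.
  move=> k l /set_mem + /set_mem; rewrite /cellS /=.
  by case: ifPn => // /set_mem ? _; case: ifPn => // /set_mem ? _ [] /cell_inj; apply.
exists (\max_(k <- t) k).+1 => k; rewrite tE /= ltnS => kt.
by rewrite (big_rem k) //= leq_maxl.
Qed.
End MatrixNorm.

Section Lorentz.
Variables (R : realType) (n : nat) (B : 'M[R]_n).
Hypothesis hB : lorentzian B.

Lemma lorentz_basis : exists (P : 'M[R]_n) (d : 'rV[R]_n) (i0 : 'I_n),
  [/\ P \in unitmx, P *m B *m P^T = diag_mx d, d ord0 i0 < 0 &
      forall i, i != i0 -> 0 < d ord0 i].
Proof.
have [P [uP /diag_mxP[d Dd] pos neg]] := hB; exists P, d.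
have dE i : (P *m B *m P^T) i i = d ord0 i by rewrite Dd mxE eqxx.
have /eqP/cards1P[i0 i0E] := neg; exists i0; split=> //.
  by have := set11 i0; rewrite -i0E inE dE.
move=> i ii0; rewrite -dE.
set Pos := finset _ in pos.
have sub : Pos \subset ~: [set i0].
  apply/fintype.subsetP => j; rewrite -i0E !inE => /ltW; rewrite leNgt.
  exact: contraNN.
have : Pos = ~: [set i0].
  by apply/eqP; rewrite eqEcard sub cardsC1 card_ord pos /=.
by move=> /setP/(_ i); rewrite !inE ii0.
Qed.

Lemma lorentz_unitmx : B \in unitmx.
Proof.
have [P [d [i0 [uP PBP d0 dpos]]]] := lorentz_basis.
have : \det (P *m B *m P^T) != 0.
  rewrite PBP det_diag; apply/prodf_neq0 => i _.
  by have [->|/dpos/gt_eqF->//] := eqVneq i i0; rewrite lt_eqF.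
rewrite !det_mulmx !mulf_eq0 !negb_or => /andP[/andP[_ B0] _].
by rewrite unitmxE unitfE.
Qed.

(** [r] is the coordinate along the negative direction: on its kernel [B] is
    positive definite, and adding a multiple of its square to [B] makes [B]
    positive definite everywhere. *)
Lemma lorentz_bound : exists (r : 'rV[R]_n) (K L : R), 0 <= K /\
  forall y : 'cV[R]_n,
    `|y| ^+ 2 <= K * bform B y y + L * (r *m y) ord0 ord0 ^+ 2.
Proof.
have [P [d [i0 [uP PBP d0 dpos]]]] := lorentz_basis.
(* [K1] bounds the inverse of every positive diagonal entry. *)
pose K1 : R := 1 + \sum_(i | i != i0) (d ord0 i)^-1.
pose N : R := (n%:R * `|P^T|) ^+ 2.
have sum0 : 0 <= \sum_(i | i != i0) (d ord0 i)^-1.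
  by apply: sumr_ge0 => i /dpos/ltW; rewrite invr_ge0.
have K10 : 0 <= K1 by rewrite addr_ge0.
have N0 : 0 <= N by exact: sqr_ge0.
exists (row i0 (invmx P)^T), (N * K1), (N * (1 - K1 * d ord0 i0)).
split=> [|y]; first exact: mulr_ge0.
pose z := (invmx P)^T *m y.
have yE : y = P^T *m z by rewrite mulmxA -trmx_mul mulVmx // trmx1 mul1mx.
have zE : (row i0 (invmx P)^T *m y) ord0 ord0 = z i0 ord0.
  by rewrite -row_mul mxE.
have BE : bform B y y = \sum_i d ord0 i * z i ord0 ^+ 2.
  rewrite /bform; have -> : y^T *m B *m y = z^T *m (P *m B *m P^T) *m z.
    by rewrite yE trmx_mul trmxK !mulmxA.
  rewrite PBP mxE; apply: eq_bigr => i _.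
  by rewrite mul_mx_diag !mxE expr2 mulrAC mulrC.
pose S := \sum_(i | i != i0) d ord0 i * z i ord0 ^+ 2.
have BS : bform B y y = d ord0 i0 * z i0 ord0 ^+ 2 + S by rewrite BE (bigD1 i0).
have term0 i : i != i0 -> 0 <= d ord0 i * z i ord0 ^+ 2.
  by move=> /dpos/ltW di; rewrite mulr_ge0 // sqr_ge0.
have S0 : 0 <= S by exact: sumr_ge0.
have zi i : z i ord0 ^+ 2 <= K1 * S + z i0 ord0 ^+ 2.
  have [->|ii0] := eqVneq i i0; first by rewrite lerDr mulr_ge0.
  apply: (@le_trans _ _ (K1 * S)); last by rewrite lerDl sqr_ge0.
  have di : 0 < d ord0 i := dpos i ii0.
  apply: (@le_trans _ _ ((d ord0 i)^-1 * (d ord0 i * z i ord0 ^+ 2))).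
    by rewrite mulKf // gt_eqF.
  apply: ler_pM; rewrite ?invr_ge0 ?(ltW di) ?term0 //.
    rewrite /K1 (bigD1 i) //= addrCA lerDl addr_ge0 // sumr_ge0 //.
    by move=> j /andP[/dpos/ltW + _]; rewrite invr_ge0.
  by rewrite /S (bigD1 i) //= lerDl sumr_ge0 // => j /andP[/term0].
have z2 : `|z| ^+ 2 <= K1 * S + z i0 ord0 ^+ 2.
  have [->|/mx_norm_attained[[i j] ->]] := eqVneq z 0.
    rewrite normr0 expr2 mul0r; apply: addr_ge0; [exact: mulr_ge0|exact: sqr_ge0].
  by rewrite ord1 /= real_normK ?num_real.
rewrite zE BS; apply: (@le_trans _ _ (N * `|z| ^+ 2)); last by nra.
rewrite {1}yE -exprMn ler_pXn2r ?nnegrE ?mulr_ge0 //.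
exact: mx_norm_mul.
Qed.

End Lorentz.

(** * Neighbourhoods in projective space and discreteness *)

Section ProjectiveNbhs.
Variables (R : realType) (n : nat).

Lemma open_scale_ball (e : 'cV[R]_n) eps :
  open [set v : 'cV[R]_n | exists2 t : R, t != 0 & `|t *: v - e| < eps].
Proof.
have -> : [set v : 'cV[R]_n | exists2 t : R, t != 0 & `|t *: v - e| < eps] =
    \bigcup_(t in [set t : R | t != 0]) (( *:%R t) @^-1` ball e eps).
  apply/seteqP; split=> v /=.
    by move=> [t t0 tv]; exists t => //=; rewrite -ball_normE /= distrC.
  by move=> [t /= t0]; rewrite -ball_normE /= distrC => tv; exists t.
apply: bigcup_open => t _; apply: open_comp; last exact: ball_open.
by move=> v _; exact: scaler_continuous.
Qed.

(** A neighbourhood of a line, seen through multiples of spanning vectors that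
    approach a fixed vector of that line. *)
Lemma nbhs_hat (e : nzvec R n) (U : set (projspace R n)) :
  nbhs (hat e) U <->
  exists2 eps : R, 0 < eps & forall (y : nzvec R n) (t : R),
    t != 0 -> `|t *: val y - val e| < eps -> U (hat y).
Proof.
split=> [|[eps eps0 epsU]].
  rewrite nbhsE => -[V [/open_projspace + Ve] VU].
  rewrite /open /= => -[A Aop AV].
  have Ae : A (val e) by rewrite -[A _]/((val @^-1` A) e) AV.
  have /nbhs_ballP[eps /= eps0 epsA] := open_nbhs_nbhs (conj Aop Ae).
  exists eps => // y t t0 ty; apply: VU.
  have ty0 : t *: val y != 0 by rewrite scaler_eq0 negb_or t0 nzvec_neq0.
  have -> : hat y = hat (mk_nzvec ty0).
    apply/hatP; exists t^-1; first by rewrite invr_eq0.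
    by rewrite /= scalerK.
  have : (hat @^-1` V) (mk_nzvec ty0).
    by rewrite -AV /=; apply: epsA; rewrite -ball_normE /= distrC.
  by [].
rewrite nbhsE; exists (hat @` [set y : nzvec R n |
    exists2 t : R, t != 0 & `|t *: val y - val e| < eps]); last first.
  by move=> _ [y [t t0 ty] <-]; exact: epsU t0 ty.
split; last first.
  by exists e => //; exists 1; rewrite ?oner_eq0 // scale1r subrr normr0.
apply/open_projspace.
exists [set v : 'cV[R]_n | exists2 t : R, t != 0 & `|t *: v - val e| < eps].
  exact: open_scale_ball.
apply/seteqP; split=> y /=; first by move=> yt; exists y.
move=> [y' [t t0 ty] /hatP[a a0 yE]]; exists (t * a); first by rewrite mulf_neq0.
by rewrite -scalerA -yE.
Qed.

End ProjectiveNbhs.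

Section Discreteness.
Variables (R : realType) (n : nat) (W : groupType) (s : 'I_n -> W).
Variables (m : coxeter_mx n) (c : 'M[R]_n).
Hypotheses (hW : is_coxeter_system s m) (hc : weights_ok m c).
Variable rho : geometric_action s (gram_mx m c).
Hypothesis uB : gram_mx m c \in unitmx.

Local Notation B := (gram_mx m c).

Lemma act_tr_gram w : (rho w)^T *m B *m rho w = B.
Proof.
apply/matrixP => i j; have := bform_act hW hc rho w (delta_mx i ord0) (delta_mx j ord0).
by rewrite /bform trmx_mul trmx_delta -!mulmxA -!rowE !mulmxA -!colE !mxE.
Qed.

(** Since [W] preserves a nondegenerate form, the inverse of a matrix in [W]
    is bounded in terms of the matrix. *)
Lemma act_mxV w : rho (w^-1)%g = invmx B *m (rho w)^T *m B.
Proof.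
rewrite -mulmxA; apply: (canRL (mulKmx uB)).
have /(congr1 (mulmx^~ (rho (w^-1)%g))) := act_tr_gram w.
by rewrite -mulmxA -act_mxM mulgV act_mx1 mulmx1 => ->.
Qed.

Lemma act_mx_separated u v : u != v -> 1 <= `|rho (v^-1)%g *m (rho u - rho v)|.
Proof.
move=> uv; have : (v^-1 * u != 1)%g.
  apply: contraNneq uv => /(congr1 (fun x => v * x)%g).
  by rewrite mulgA mulgV mul1g mulg1 => ->.
move=> /(act_diag_le0 hW hc rho)[a a0].
apply: le_trans (ler_mx_entry _ a a).
rewrite mulmxBr -!act_mxM mulVg act_mx1 !mxE eqxx ler_normr.
by apply/orP; right; rewrite mulr1n; lra.
Qed.

(** Elements whose matrices are bounded by [M] are uniformly separated, because
    the inverses are bounded too. *)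
Lemma act_norm_escapes (w : nat -> W) (M : R) : injective w ->
  exists N, forall k, (N <= k)%N -> M < `|rho (w k)|.
Proof.
move=> winj; pose S := [set k | `|rho (w k)| <= M].
(* For [|rho v| <= M], [D] exceeds [n] times the norm of [rho v^-1]. *)
pose D : R := n%:R * (n%:R * (n%:R * `|invmx B| * `|M|) * `|B|) + 1.
have D0 : 0 < D by rewrite ltr_wpDl ?mulr_ge0.
have [|k Sk|k l Sk Sl kl|N NS] :=
    @separated_bounded_finite R n n (rho \o w) S M D^-1.
- by rewrite invr_gt0.
- exact: Sk.
- have := act_mx_separated (contra_neq (@winj k l) kl) => sep.
  have lM : `|rho (w l)| <= `|M| by apply: le_trans Sl (ler_norm M).
  have lV : n%:R * `|rho ((w l)^-1)%g| <= D - 1.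
    rewrite addrK ler_wpM2l // act_mxV; apply: le_trans (mx_norm_mul _ _) _.
    rewrite ler_wpM2r // ler_wpM2l //; apply: le_trans (mx_norm_mul _ _) _.
    by rewrite mx_norm_tr ler_wpM2l // mulr_ge0.
  rewrite -(ler_pM2l D0) mulfV ?gt_eqF //; apply: le_trans sep _.
  apply: le_trans (mx_norm_mul _ _) _; rewrite ler_wpM2r //.
  by apply: le_trans lV _; rewrite gerBl.
exists N => k Nk; rewrite ltNge; apply: contraL Nk => /NS.
by rewrite -ltnNge.
Qed.

End Discreteness.

(** * Long roots almost orthogonal to a vector *)

Section LimitRoots.
Variables (R : realType) (n : nat) (W : groupType) (s : 'I_n -> W).
Variables (m : coxeter_mx n) (c : 'M[R]_n).
Hypotheses (hW : is_coxeter_system s m) (hc : weights_ok m c).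
Variable rho : geometric_action s (gram_mx m c).
Hypothesis hB : lorentzian (gram_mx m c).

Local Notation B := (gram_mx m c).
Local Notation alpha := (@simple_root R n).

(** There are arbitrarily long roots almost orthogonal to [e] relative to their
    length. For isotropic [e] their directions then approach that of [e]. *)
Definition root_asymptotic (e : 'cV[R]_n) := forall eps M : R, 0 < eps ->
  exists w i, M < `|rho w *m alpha i| /\
    `|bform B e (rho w *m alpha i)| <= eps * `|rho w *m alpha i|.

Lemma root_asymptoticZ a e : root_asymptotic e -> root_asymptotic (a *: e).
Proof.
move=> He eps M eps0.
have a1 : 0 < `|a| + 1 by rewrite ltr_wpDl.
have [w [i [Mg eg]]] := He (eps / (`|a| + 1)) M (divr_gt0 eps0 a1).
exists w, i; split=> //; rewrite bformZl normrM.
apply: le_trans (ler_wpM2l (normr_ge0 a) eg) _; rewrite mulrA ler_wpM2r //.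
by rewrite mulrCA ler_piMr ?(ltW eps0) // ler_pdivrMr // mul1r lerDl.
Qed.

Lemma root_asymptotic_act u e : root_asymptotic e -> root_asymptotic (rho u *m e).
Proof.
move=> He eps M eps0.
pose D : R := n%:R * `|rho (u^-1)%g| + 1.
have D0 : 0 < D by rewrite ltr_wpDl ?mulr_ge0.
have [w [i [Mg eg]]] := He (eps / D) (D * `|M|) (divr_gt0 eps0 D0).
exists (u * w)%g, i; rewrite act_mxM -mulmxA (bform_act hW hc).
set g := rho w *m alpha i in Mg eg *.
have gD : `|g| <= D * `|rho u *m g|.
  have {1}-> : g = rho (u^-1)%g *m (rho u *m g).
    by rewrite mulmxA -act_mxM mulVg act_mx1 mul1mx.
  by apply: le_trans (mx_norm_mul _ _) _; rewrite ler_wpM2r // lerDl.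
split.
  apply: le_lt_trans (ler_norm M) _.
  by rewrite -(ltr_pM2l D0) (lt_le_trans Mg).
apply: le_trans eg _; rewrite -mulrA ler_wpM2l ?(ltW eps0) //.
by rewrite mulrC ler_pdivrMr // mulrC.
Qed.

Lemma root_asymptotic_closed e :
  (forall eta : R, 0 < eta -> exists2 e', root_asymptotic e' & `|e' - e| <= eta) ->
  root_asymptotic e.
Proof.
move=> He eps M eps0; have [C C0 CB] := bform_bounded B.
have eps2 : 0 < eps / 2 by rewrite divr_gt0.
have [e' He' ee'] := He (eps / 2 / C) (divr_gt0 eps2 C0).
have [w [i [Mg eg]]] := He' _ M eps2.
exists w, i; split=> //; set g := rho w *m alpha i in Mg eg *.
have -> : bform B e g = bform B e' g + bform B (e - e') g.
  by rewrite -bformDl addrC subrK.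
apply: le_trans (ler_normD _ _) _; rewrite [eps in leRHS]splitr mulrDl.
apply: lerD => //; apply: le_trans (CB _ _) _; rewrite ler_wpM2r //.
by rewrite mulrC -ler_pdivlMr // distrC.
Qed.

Lemma mx_norm_root (A : 'M[R]_n) : 0 < `|A| -> exists i, `|A| <= `|A *m alpha i|.
Proof.
rewrite normr_gt0 => /mx_norm_attained[[i j] /= ->]; exists j.
by rewrite -colE; have := ler_mx_entry (col j A) i ord0; rewrite mxE.
Qed.

Lemma mx_norm_alpha i : `|alpha i| <= 1.
Proof.
by apply: mx_norm_le => // j k; rewrite !mxE; case: (_ && _); rewrite ?normr1 ?normr0.
Qed.

(** For [g = w_k alpha_i] the form [B(a w_k x, g) = a B(x, alpha_i)] is bounded
    uniformly in [k], and [g] is long for some [i] when [k] is large. *)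
Lemma root_asymptotic_bounded (w : nat -> W) (x e : 'cV[R]_n) (K : R) :
  injective w ->
  (forall N (eta : R), 0 < eta -> exists k a, [/\ (N <= k)%N, `|a| <= K &
     `|a *: (rho (w k) *m x) - e| <= eta]) ->
  root_asymptotic e.
Proof.
move=> winj He eps M eps0; have [C C0 CB] := bform_bounded B.
have eps2 : 0 < eps / 2 by rewrite divr_gt0.
(* Beyond this length, [eps / 2 * |g|] exceeds the bound on [B(a w_k x, g)]. *)
pose M' := `|M| + (eps / 2)^-1 * (K * (C * `|x|)).
have [N NM] := act_norm_escapes hW hc rho (lorentz_unitmx hB) `|M'| winj.
have [k [a [Nk aK ae]]] := He N (eps / 2 / C) (divr_gt0 eps2 C0).
have Mw := NM k Nk.
have [i wi] := mx_norm_root (le_lt_trans (normr_ge0 M') Mw).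
exists (w k), i; set g := rho (w k) *m alpha i in wi *.
have K0 : 0 <= K := le_trans (normr_ge0 a) aK.
have M'g : M' < `|g| by apply: le_lt_trans (ler_norm M') (lt_le_trans Mw wi).
have KC : 0 <= K * (C * `|x|) by rewrite !mulr_ge0 ?(ltW C0).
split.
  apply: le_lt_trans (ler_norm M) _; apply: le_lt_trans M'g.
  by rewrite lerDl mulr_ge0 // invr_ge0 ltW.
have -> : bform B e g = a * bform B x (alpha i) +
    bform B (e - a *: (rho (w k) *m x)) g.
  by rewrite -(bform_act hW hc rho (w k) x) -bformZl -bformDl addrC subrK.
apply: le_trans (ler_normD _ _) _; rewrite [eps in leRHS]splitr mulrDl.
apply: lerD.
  rewrite normrM; apply: (@le_trans _ _ (K * (C * `|x|))).
    apply: ler_pM => //; apply: le_trans (CB _ _) _.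
    by rewrite ler_piMr ?mx_norm_alpha // mulr_ge0 ?(ltW C0).
  rewrite -ler_pdivrMl //; apply: le_trans (ltW M'g).
  by rewrite lerDr.
apply: le_trans (CB _ _) _; rewrite ler_wpM2r //.
by rewrite mulrC -ler_pdivlMr // distrC.
Qed.

(** With [g = w_k^-1 alpha_i], [B(x, g) = B(w_k x, alpha_i)] is of order
    [1 / |a|]; and [w_k^-1] maps [a w_k x], of bounded size, to [a x], so some
    such [g] is long. *)
Lemma root_asymptotic_base (w : nat -> W) (x e : 'cV[R]_n) : x != 0 ->
  (forall K eta : R, 0 < eta -> exists k a, K < `|a| /\
     `|a *: (rho (w k) *m x) - e| <= eta) ->
  root_asymptotic x.
Proof.
move=> x0 He eps M eps0; have [C C0 CB] := bform_bounded B.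
have nx : 0 < `|x| by rewrite normr_gt0.
pose E := `|e| + 1; have E0 : 0 < E by rewrite ltr_wpDl.
(* The first summand makes [g] long, the second makes [B(x, g)] small. *)
pose K := n%:R * E / `|x| * (`|M| + 1) + C * E / eps.
have [k [a [Ka ae]]] := He K 1 ltr01.
set u := a *: (rho (w k) *m x) in ae.
have uE : `|u| <= E.
  by rewrite -[u](subrK e) addrC; apply: le_trans (ler_normD _ _) _; rewrite lerD.
have CE : 0 < C * E / eps by rewrite divr_gt0 ?mulr_gt0.
have K0 : 0 < K by rewrite ltr_wpDl // !mulr_ge0 ?invr_ge0 ?addr_ge0 ?(ltW E0).
have na : 0 < `|a| := lt_trans K0 Ka.
have Vu : rho ((w k)^-1)%g *m u = a *: x.
  by rewrite -scalemxAr mulmxA -act_mxM mulVg act_mx1 mul1mx.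
have nV : `|a| * `|x| <= n%:R * `|rho ((w k)^-1)%g| * E.
  rewrite -mx_normZ -Vu; apply: le_trans (mx_norm_mul _ _) _.
  by rewrite ler_wpM2l // mulr_ge0.
have MV : `|M| + 1 < `|rho ((w k)^-1)%g|.
  rewrite ltNge; apply/negP => VM.
  have : `|a| * `|x| <= n%:R * (`|M| + 1) * E.
    by apply: le_trans nV _; rewrite ler_wpM2r ?(ltW E0) // ler_wpM2l.
  rewrite -ler_pdivlMr // leNgt => /negP; apply; apply: le_lt_trans Ka.
  have -> : n%:R * (`|M| + 1) * E / `|x| = n%:R * E / `|x| * (`|M| + 1) by ring.
  by rewrite lerDl ltW.
have [i wi] := mx_norm_root (lt_trans (ltr_wpDl (normr_ge0 M) ltr01) MV).
exists (w k)^-1%g, i; set g := rho _ *m alpha i in wi *.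
have Mg := lt_le_trans MV wi; split.
  by apply: le_lt_trans (ler_norm M) (lt_trans _ Mg); rewrite ltrDl.
apply: (@le_trans _ _ eps); last first.
  by rewrite ler_peMr ?(ltW eps0) //; apply: ltW; apply: le_lt_trans Mg; rewrite lerDr.
have -> : bform B x g = a^-1 * bform B u (alpha i).
  have a0 : a != 0 by rewrite -normr_gt0.
  rewrite -(bform_act hW hc rho (w k)^-1%g u) Vu bformZl mulKf //.
rewrite normrM normfV ler_pdivrMl //; apply: le_trans (CB _ _) _.
apply: (@le_trans _ _ (C * E)).
  rewrite -[leRHS]mulr1; apply: ler_pM; rewrite ?mx_norm_alpha //.
    by rewrite mulr_ge0 ?(ltW C0).
  by rewrite ler_wpM2l ?(ltW C0).
rewrite -ler_pdivrMr //; apply: ltW; apply: le_lt_trans Ka.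
by rewrite lerDr !mulr_ge0 ?invr_ge0 ?addr_ge0 ?(ltW E0).
Qed.

(** Either the scaling factors stay bounded along a subsequence, and the roots
    [w_k alpha_i] work, or they do not, and the property passes from [x] to its
    orbit and then to [e]. *)
Lemma root_asymptotic_limit (w : nat -> W) (x e : 'cV[R]_n) :
  injective w -> x != 0 ->
  (forall eta : R, 0 < eta -> exists N, forall k, (N <= k)%N ->
     exists a, `|a *: (rho (w k) *m x) - e| <= eta) ->
  root_asymptotic e.
Proof.
move=> winj x0 He.
have [[K HK]|/forallNP HK] := pselect (exists K : R,
    forall N (eta : R), 0 < eta -> exists k a, [/\ (N <= k)%N, `|a| <= K &
      `|a *: (rho (w k) *m x) - e| <= eta]).
  exact: root_asymptotic_bounded winj HK.
have far (K eta : R) : 0 < eta -> exists k a, K < `|a| /\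
    `|a *: (rho (w k) *m x) - e| <= eta.
  move=> eta0; apply: contrapT => Hfar; apply: (HK K) => N eta' eta'0.
  have min0 : 0 < Num.min eta eta' by rewrite lt_min eta0.
  have [N' HN'] := He _ min0.
  have [a] := HN' (maxn N N') (leq_maxr _ _).
  rewrite le_min => /andP[ae ae']; exists (maxn N N'), a; split=> //.
    exact: leq_maxl.
  by rewrite leNgt; apply/negP => Ka; apply: Hfar; exists (maxn N N'), a.
apply: root_asymptotic_closed => eta /(far 0)[k [a [_ ae]]].
exists (a *: (rho (w k) *m x)) => //.
exact/root_asymptoticZ/root_asymptotic_act/(root_asymptotic_base x0 far).
Qed.

End LimitRoots.

Section AsymptoticLimitRoot.
Variables (R : realType) (n : nat) (W : groupType) (s : 'I_n -> W).
Variables (m : coxeter_mx n) (c : 'M[R]_n).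
Hypotheses (hW : is_coxeter_system s m) (hc : weights_ok m c).
Variable rho : geometric_action s (gram_mx m c).
Hypothesis hB : lorentzian (gram_mx m c).

Local Notation B := (gram_mx m c).
Local Notation alpha := (@simple_root R n).

(** Subtract from the root [g] the multiple [t e] that puts [z = g - t e] in the
    kernel of the linear form [phi]. There [B] controls the norm, and
    [B(z, z) = 1 - 2 t B(e, g)] is small compared with [|g| ^ 2]. *)
Lemma root_asymptotic_approx (e : 'cV[R]_n) (eta M : R) :
  e != 0 -> bform B e e = 0 -> root_asymptotic rho e -> 0 < eta ->
  exists w i, M < `|rho w *m alpha i| /\
    exists2 t, t != 0 & `|t *: (rho w *m alpha i) - e| < eta.
Proof.
move=> e0 ee He eta0; have [r [K [L [K0 rB]]]] := lorentz_bound hB.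
pose phi (y : 'cV[R]_n) := (r *m y) ord0 ord0.
have ne : 0 < `|e| by rewrite normr_gt0.
have phie : phi e != 0.
  apply: contraTneq (rB e) => phie.
  by rewrite -ltNge -/(phi e) phie ee expr0n !mulr0 addr0 exprn_gt0.
pose D : R := n%:R * `|r| / `|phi e|.
have D0 : 0 <= D by rewrite divr_ge0 // mulr_ge0.
(* With [|z| <= zeta |g|] and [zeta <= 1 / 2] one gets [|z / t| <= 2 zeta |e|]. *)
pose zeta := eta / (2 * eta + 4 * `|e|).
have den0 : 0 < 2 * eta + 4 * `|e| by lra.
have zeta0 : 0 < zeta by rewrite divr_gt0.
have zeta2 : zeta <= 1 / 2 by rewrite ler_pdivrMr //; lra.
have zetae : 2 * zeta * `|e| < eta.
  have -> : 2 * zeta * `|e| = 2 * eta * `|e| / (2 * eta + 4 * `|e|).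
    by rewrite /zeta mulrA [RHS]mulrAC.
  by rewrite ltr_pdivrMr //; nra.
(* [eps] and [M'] bound the two terms of [K * B(z, z)], each by half of
   [(zeta * |g|) ^ 2]. *)
pose eps := zeta ^+ 2 / (4 * D * K + 1).
have DK1 : 0 < 4 * D * K + 1 by rewrite ltr_wpDl // !mulr_ge0.
have eps0 : 0 < eps by rewrite divr_gt0 // exprn_gt0.
pose M' := `|M| + 2 * K / zeta ^+ 2 + 1.
have [w [i [Mg eg]]] := He eps M' eps0.
exists w, i; set g := rho w *m alpha i in Mg eg *.
have KZ : 0 <= 2 * K / zeta ^+ 2 by rewrite divr_ge0 ?sqr_ge0 ?mulr_ge0.
split; first by apply: le_lt_trans Mg; rewrite /M'; have := ler_norm M; lra.
have g1 : 1 <= `|g|.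
  by apply: ltW (le_lt_trans _ Mg); rewrite /M'; have := normr_ge0 M; lra.
pose t := phi g / phi e; pose z := g - t *: e.
have tD : `|t| <= D * `|g|.
  rewrite /t normrM normfV mulrAC ler_wpM2r ?invr_ge0 //.
  by apply: le_trans (ler_mx_entry _ _ _) _; rewrite mx_norm_mul.
have phiz : phi z = 0.
  rewrite /phi /z mulmxBr -scalemxAr mxE [X in _ + X]mxE [X in _ - X]mxE.
  by rewrite divfK ?subrr.
have gg : bform B g g = 1.
  by rewrite (bform_act hW hc) bform_simple (gram_diag _ hW).
have zz : bform B z z = 1 - 2 * t * bform B e g.
  rewrite /z -scaleNr bformDl bformZl ![bform B _ (_ + _)](bformC hW hc).
  rewrite !bformDl !bformZl gg ee (bformC hW hc g e); ring.
have z2 : `|z| ^+ 2 <= (zeta * `|g|) ^+ 2.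
  have := rB z; rewrite -/(phi z) phiz zz expr0n mulr0 addr0 => zle.
  have tB : `|t * bform B e g| <= D * eps * `|g| ^+ 2.
    rewrite normrM expr2 mulrACA; exact: ler_pM.
  have KD : K * (2 * (D * eps * `|g| ^+ 2)) <= (zeta * `|g|) ^+ 2 / 2.
    have -> : K * (2 * (D * eps * `|g| ^+ 2)) =
      (4 * D * K / (4 * D * K + 1)) * ((zeta * `|g|) ^+ 2 / 2).
      rewrite /eps; move: DK1 => /gt_eqF/negbT.
      by move: (zeta) (D) `|g| => a b d q; field.
    rewrite ler_piMl ?divr_ge0 ?sqr_ge0 // ler_pdivrMr // mul1r.
    by rewrite lerDl.
  have KM : K <= (zeta * `|g|) ^+ 2 / 2.
    rewrite exprMn -mulrA -ler_pdivrMl ?exprn_gt0 // ler_pdivlMr //.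
    apply: (@le_trans _ _ `|g|); last by rewrite ler_eXnr.
    apply: ltW; apply: le_lt_trans Mg; rewrite /M'.
    by have := normr_ge0 M; lra.
  apply: le_trans zle _; move: tB; rewrite ler_norml => /andP[tB _].
  have : K * (- 2 * t * bform B e g) <= K * (2 * (D * eps * `|g| ^+ 2)).
    by rewrite ler_wpM2l //; lra.
  lra.
have zg : `|z| <= zeta * `|g|.
  rewrite -(@ler_pXn2r _ 2) ?nnegrE //.
  by rewrite mulr_ge0 // ltW.
have te : `|g| / 2 <= `|t| * `|e|.
  have : `|g| <= `|t *: e| + `|z|.
    by apply: le_trans (ler_normD (t *: e) z); rewrite /z addrC subrK.
  by rewrite mx_normZ; nra.
have t0 : t != 0.
  by apply: contraTneq te => ->; rewrite normr0 mul0r -ltNge; lra.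
exists t^-1; first by rewrite invr_eq0.
have -> : t^-1 *: g - e = t^-1 *: z by rewrite scalerBr scalerK.
rewrite mx_normZ normfV ltr_pdivrMl ?normr_gt0 // -(ltr_pM2r ne).
apply: (@le_lt_trans _ _ (2 * zeta * `|e| * (`|g| / 2))); first by nra.
apply: (@lt_le_trans _ _ (eta * (`|g| / 2))).
  by rewrite ltr_pM2r // divr_gt0 // (lt_le_trans ltr01).
by rewrite [`|t| * eta]mulrC -mulrA ler_wpM2l // ltW.
Qed.

(** Choosing each root longer than the previous one makes the sequence
    injective. *)
Lemma limit_root_asymptotic (e : nzvec R n) :
  bform B (val e) (val e) = 0 -> root_asymptotic rho (val e) ->
  limit_root rho (hat e).
Proof.
move=> ee He.
pose root (p : W * 'I_n) := rho p.1 *m alpha p.2.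
have /choice[pick pickP] : forall q : nat * R, exists p : W * 'I_n,
    q.2 < `|root p| /\
    exists2 t, t != 0 & `|t *: root p - val e| < q.1.+1%:R^-1.
  move=> [k M]; have k0 : 0 < k.+1%:R^-1 :> R by rewrite invr_gt0.
  have [w [i [Mg te]]] :=
    root_asymptotic_approx M (nzvec_neq0 e) ee He k0.
  by exists (w, i).
pose p := fix p k := if k is k'.+1 then pick (k, `|root (p k')|) else pick (0, 0).
have p_lt k : `|root (p k)| < `|root (p k.+1)|.
  by have [] := pickP (k.+1, `|root (p k)|).
have p_near k : exists2 t, t != 0 & `|t *: root (p k) - val e| < k.+1%:R^-1.
  by case: k => [|k]; [have [] := pickP (0, 0)|have [] := pickP (k.+1, `|root (p k)|)].
have p_inj : injective (fun k => `|root (p k)|).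
  have lt_homo := homo_ltn lt_trans p_lt.
  move=> k l kl; case: (ltngtP k l) => // /lt_homo; rewrite kl ltxx //.
pose g k := act_nz rho (p k).1 (mk_nzvec (simple_root_neq0 R (p k).2)).
exists g; split.
- move=> k l /(congr1 val) gkl; apply: p_inj.
  by rewrite /root -[rho _ *m _]/(val (g k)) gkl.
- by move=> k; exists (p k).1, (p k).2.
move=> U /nbhs_hat[eps eps0 epsU].
have [N HN] : exists N : nat, N.+1%:R^-1 < eps.
  exists (Num.trunc eps^-1); rewrite -[ltRHS]invrK ltf_pV2 ?posrE ?invr_gt0 //.
  exact: truncnS_gt.
exists N => // k /= Nk; have [t t0 tk] := p_near k.
apply: (epsU (g k) t t0); apply: lt_trans tk _; apply: le_lt_trans HN.
by rewrite lef_pV2 ?posrE // ler_nat ltnS.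
Qed.

End AsymptoticLimitRoot.

(** * Limit directions on the light cone *)

Theorem theorem2p5 (R : realType) (n : nat) (W : groupType) (s : 'I_n -> W)
    (m : coxeter_mx n) (c : 'M[R]_n)
    (hW : is_coxeter_system s m) (hc : weights_ok m c)
    (rho : geometric_action s (gram_mx m c))
    (hB : lorentzian (gram_mx m c))
    (w : nat -> W) (x0 : nzvec R n) (x : projspace R n)
    (hinj : injective (fun k => act_proj rho (w k) (hat x0)))
    (hcvg : (fun k => act_proj rho (w k) (hat x0)) @ \oo --> x)
    (hdir : limit_direction rho x)
    (hcone : light_cone (gram_mx m c) x) :
  limit_root rho x.
Proof.
have [e xe ee] := hcone; rewrite xe in hcvg *.
apply: (limit_root_asymptotic hW hc hB ee).
apply: (@root_asymptotic_limit _ _ _ _ _ _ hW hc rho hB w (val x0)).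
- by move=> k l wkl; apply: hinj; rewrite /= wkl.
- exact: nzvec_neq0.
move=> eta eta0.
have /hcvg[N _ HN] : nbhs (hat e) [set L | forall y : nzvec R n, L = hat y ->
    exists a, `|a *: val y - val e| <= eta].
  apply/nbhs_hat; exists eta => // y t t0 ty z /hatP[a a0 yz].
  by exists (t * a); rewrite -scalerA -yz ltW.
by exists N => k Nk; apply: (HN k Nk (act_nz rho (w k) x0)); rewrite act_proj_hat.
Qed.
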